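(* The class of specialization semilattices has the strong amalgamation property. The class of finite specialization semilattices has a Fraïssé limit $\mathbf M$. The first-order theory of $\mathbf M$ is $\omega$-categorical, has quantifier elimination and is the model-completion of the theory of specialization semilattices.
   Context: Semilattices are join-semilattices, with induced order $a \leq b$ iff $a \vee b = b$. A specialization semilattice is a triple $(S, \vee, \sqsubseteq)$ such that $(S, \vee)$ is a semilattice and $\sqsubseteq$ is a binary relation on $S$ satisfying, for all $a, b, c, a_1 \in S$: (S1) $a \leq b$ implies $a \sqsubseteq b$; (S2) $a \sqsubseteq b$ and $b \sqsubseteq c$ imply $a \sqsubseteq c$; (S3) $a \sqsubseteq b$ and $a_1 \sqsubseteq b$ imply $a \vee a_1 \sqsubseteq b$. The theory of specialization semilattices is the universal first-order theory, in the language $\{\vee, \sqsubseteq\}$, axiomatized by these conditions. Embeddings are injective functions preserving $\vee$ and both preserving and reflecting $\sqsubseteq$. A class $\mathcal K$ of models of the same type has the amalgamation property if, for all $\mathbf S, \mathbf A, \mathbf B \in \mathcal K$ and embeddings $\lambda : \mathbf S \to \mathbf A$, $\theta : \mathbf S \to \mathbf B$, there are $\mathbf D \in \mathcal K$ and embeddings $\lambda_1 : \mathbf A \to \mathbf D$, $\theta_1 : \mathbf B \to \mathbf D$ such that $\lambda_1 \circ \lambda = \theta_1 \circ \theta$. It has the strong amalgamation property if moreover one can always get that the intersection of the images $\lambda_1(A) \cap \theta_1(B)$ equals $(\lambda_1 \circ \lambda)(S)$. The age of a model $\mathbf M$ is the class of all finitely generated models that can be embedded in $\mathbf M$. A model $\mathbf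 M$ is homogeneous if every isomorphism between finitely generated submodels of $\mathbf M$ extends to an automorphism of $\mathbf M$. For a class $\mathcal H$ of finitely generated models in a countable type, a Fraïssé limit of $\mathcal H$ is a countable (universal) homogeneous model of age $\mathcal H$. A theory is $\omega$-categorical if all its countably infinite models are isomorphic. A first-order theory is model-complete if every embedding between its models is elementary. $T^*$ is the model-completion of $T$ if $T$ and $T^*$ have the same universal consequences, $T$ has the amalgamation property (i.e. its class of models does) and $T^*$ is model-complete. *)

(* Defs.v *)
From mathcomp Require Import all_boot.
From mathcomp Require Import boolp classical_sets functions cardinality.

Set Implicit Arguments.
Unset Strict Implicit.
Unset Printing Implicit Defensive.

Local Open Scope classical_set_scope.
Local Open Scope card_scope.

(* Carriers may be empty; this is why valuations below are indexed by 'I_n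
   and not by nat, for which an empty carrier has no valuation at all. *)
Record structure := Structure {
  carrier :> Type;
  join : carrier -> carrier -> carrier;
  spec : carrier -> carrier -> Prop
}.

Arguments join {_} _ _.
Arguments spec {_} _ _.

Notation "a \v b" := (join a b) (at level 50, left associativity).
Notation "a \sq b" := (spec a b) (at level 70, no associativity).

Definition sle (S : structure) (a b : S) : Prop := a \v b = b.

Record specialization_semilattice (S : structure) : Prop :=
  SpecializationSemilattice {
    ss_assoc : associative (@join S);
    ss_comm : commutative (@join S);
    ss_idem : idempotent_op (@join S);
    ss_S1 : forall a b : S, sle a b -> a \sq b;
    ss_S2 : forall a b c : S, a \sq b -> b \sq c -> a \sq c;
    ss_S3 : forall a b a1 : S, a \sq b -> a1 \sq b -> a \v a1 \sq b
  }.

Record embedding (A B : structure) (f : A -> B) : Prop := Embedding {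
  emb_inj : injective f;
  emb_join : {morph f : a b / a \v b >-> a \v b};
  emb_spec : forall a b, a \sq b <-> f a \sq f b
}.

Definition isomorphism (A B : structure) (f : A -> B) : Prop :=
  embedding f /\ bijective f.

Definition embeddable (A B : structure) : Prop :=
  exists f : A -> B, embedding f.

Definition isomorphic (A B : structure) : Prop :=
  exists f : A -> B, isomorphism f.

Definition finite_structure (A : structure) : Prop := finite_set [set: A].

Definition countable_structure (A : structure) : Prop := countable [set: A].

Definition countably_infinite (A : structure) : Prop :=
  [set: A] #= [set: nat].

Definition specialization_semilattices : set structure :=
  [set S | specialization_semilattice S].

Definition finite_specialization_semilattices : set structure :=
  [set S | specialization_semilattice S /\ finite_structure S].

Definition amalgamation_property (K : set structure) : Prop :=
  forall S A B : structure, K S -> K A -> K B ->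
  forall (l : S -> A) (t : S -> B), embedding l -> embedding t ->
  exists (D : structure) (l1 : A -> D) (t1 : B -> D),
    [/\ K D, embedding l1, embedding t1 & l1 \o l = t1 \o t].

Definition strong_amalgamation_property (K : set structure) : Prop :=
  forall S A B : structure, K S -> K A -> K B ->
  forall (l : S -> A) (t : S -> B), embedding l -> embedding t ->
  exists (D : structure) (l1 : A -> D) (t1 : B -> D),
    [/\ K D, embedding l1, embedding t1, l1 \o l = t1 \o t
      & range l1 `&` range t1 = range (l1 \o l)].

Definition join_closed (M : structure) (X : set M) : Prop :=
  forall a b : M, X a -> X b -> X (a \v b).

Record submodel (M : structure) := Submodel {
  submodel_set : set M;
  submodel_closed : join_closed submodel_set
}.

Definition submodel_structure (M : structure) (P : submodel M) : structure :=
  @Structure {x : M | submodel_set P x}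
    (fun a b => exist _ (sval a \v sval b)
                        (submodel_closed (svalP a) (svalP b)))
    (fun a b => sval a \sq sval b).

Coercion submodel_structure : submodel >-> structure.

Definition incl (M : structure) (P : submodel M) : P -> M :=
  fun x => sval x.

Definition finitely_generated (A : structure) : Prop :=
  exists X : set A, finite_set X /\ smallest (@join_closed A) X = [set: A].

Definition age (M : structure) : set structure :=
  [set A | finitely_generated A /\ embeddable A M].

Definition homogeneous (M : structure) : Prop :=
  forall P Q : submodel M, finitely_generated P -> finitely_generated Q ->
  forall f : P -> Q, isomorphism f ->
  exists g : M -> M, isomorphism g /\ forall x : P, g (incl x) = incl (f x).

(* Universality is [age M = H]: every model in [H] embeds in [M]. *)
Definition fraisse_limit (H : set structure) (M : structure) : Prop :=
  [/\ countable_structure M, homogeneous M & age M = H].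

(* [term n] and [formula n] have their free variables in 'I_n. In [All phi] the
   bound variable is variable 0 of [phi], and variable i.+1 of [phi] is variable
   i of the context. The other connectives are classically definable. *)
Inductive term (n : nat) : Type :=
  | Var of 'I_n
  | Join of term n & term n.

Inductive formula : nat -> Type :=
  | Bot n : formula n
  | Eq n of term n & term n : formula n
  | Spec n of term n & term n : formula n
  | Imp n of formula n & formula n : formula n
  | All n of formula n.+1 : formula n.

Arguments Bot {n}.
Arguments Join {n} & _ _.
Arguments Eq {n} & _ _.
Arguments Spec {n} & _ _.
Arguments Imp {n} & _ _.

Definition sentence : Type := formula 0.
Definition theory : Type := set sentence.

Definition scons (T : Type) (n : nat) (x : T) (v : 'I_n -> T) (i : 'I_n.+1) :
    T :=
  match i with
  | @Ordinal _ 0 _ => x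
  | @Ordinal _ k.+1 lt_k_n => v (@Ordinal n k lt_k_n)
  end.

Definition no_var (T : Type) (i : 'I_0) : T :=
  match notF (ltn_ord i) with end.

Fixpoint eval (M : structure) (n : nat) (v : 'I_n -> M) (t : term n) : M :=
  match t with
  | Var i => v i
  | Join s t => eval v s \v eval v t
  end.

Fixpoint sat (M : structure) (n : nat) (phi : formula n) : ('I_n -> M) -> Prop :=
  match phi in formula n return ('I_n -> M) -> Prop with
  | Bot _ => fun _ => False
  | Eq _ s t => fun v => eval v s = eval v t
  | Spec _ s t => fun v => eval v s \sq eval v t
  | Imp _ phi psi => fun v => sat phi v -> sat psi v
  | All _ phi => fun v => forall x : M, sat phi (scons x v)
  end.

Fixpoint quantifier_free (n : nat) (phi : formula n) : bool :=
  match phi with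
  | Bot _ | Eq _ _ _ | Spec _ _ _ => true
  | Imp _ phi psi => quantifier_free phi && quantifier_free psi
  | All _ _ => false
  end.

Fixpoint universal_closure (n : nat) : formula n -> sentence :=
  match n with
  | 0 => fun phi => phi
  | _.+1 => fun phi => universal_closure (All phi)
  end.

Definition universal_sentence (phi : sentence) : Prop :=
  exists (n : nat) (psi : formula n),
    quantifier_free psi /\ phi = universal_closure psi.

Definition holds (M : structure) (phi : sentence) : Prop :=
  sat phi (@no_var M).

Definition model_of (T : theory) (M : structure) : Prop :=
  forall phi, T phi -> holds M phi.

Definition models (T : theory) : set structure := [set M | model_of T M].

Definition consequence (T : theory) (phi : sentence) : Prop :=
  forall M : structure, model_of T M -> holds M phi.

Definition theory_of (M : structure) : theory := [set phi | holds M phi].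

Definition omega_categorical (T : theory) : Prop :=
  forall A B : structure, model_of T A -> model_of T B ->
  countably_infinite A -> countably_infinite B -> isomorphic A B.

Definition quantifier_elimination (T : theory) : Prop :=
  forall (n : nat) (phi : formula n),
  exists psi : formula n, quantifier_free psi /\
    forall (M : structure) (v : 'I_n -> M),
      model_of T M -> (sat phi v <-> sat psi v).

Definition elementary (A B : structure) (f : A -> B) : Prop :=
  forall (n : nat) (phi : formula n) (v : 'I_n -> A),
    sat phi v <-> sat phi (f \o v).

Definition model_complete (T : theory) : Prop :=
  forall A B : structure, model_of T A -> model_of T B ->
  forall f : A -> B, embedding f -> elementary f.

Definition model_completion (Tstar T : theory) : Prop :=
  [/\ forall phi, universal_sentence phi ->
        (consequence T phi <-> consequence Tstar phi),
      amalgamation_property (models T)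
    & model_complete Tstar].

Definition var (n k : nat) (lt_k_n : k < n) : term n := Var (Ordinal lt_k_n).
Arguments var {n} & k lt_k_n.
Local Notation "# k" := (var k isT) (at level 2, format "# k").

Definition assoc_axiom : sentence :=
  @universal_closure 3 (Eq (Join #0 (Join #1 #2)) (Join (Join #0 #1) #2)).
Definition comm_axiom : sentence :=
  @universal_closure 2 (Eq (Join #0 #1) (Join #1 #0)).
Definition idem_axiom : sentence :=
  @universal_closure 1 (Eq (Join #0 #0) #0).
Definition S1_axiom : sentence :=
  @universal_closure 2 (Imp (Eq (Join #0 #1) #1) (Spec #0 #1)).
Definition S2_axiom : sentence :=
  @universal_closure 3
    (Imp (Spec #0 #1) (Imp (Spec #1 #2) (Spec #0 #2))).
Definition S3_axiom : sentence :=
  @universal_closure 3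
    (Imp (Spec #0 #1) (Imp (Spec #2 #1) (Spec (Join #0 #2) #1))).

Definition specialization_semilattice_theory : theory :=
  [set assoc_axiom; comm_axiom; idem_axiom; S1_axiom; S2_axiom; S3_axiom].

Lemma models_specialization_semilattice_theory :
  models specialization_semilattice_theory = specialization_semilattices.
Proof.
apply/seteqP; split => [S mS|S [h1 h2 h3 h4 h5 h6] phi].
  split.
  - by move=> x y z; apply: (mS assoc_axiom _ z y x); do 5!left.
  - by move=> x y; apply: (mS comm_axiom _ y x); do 4!left; right.
  - by move=> x; apply: (mS idem_axiom _ x); do 3!left; right.
  - by move=> x y; apply: (mS S1_axiom _ y x); do 2!left; right.
  - by move=> x y z; apply: (mS S2_axiom _ z y x); left; right.
  - by move=> x y z; apply: (mS S3_axiom _ z y x); right.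
case=> [[[[[]|]|]|]|] -> /=.
- by move=> z y x; apply: h1.
- by move=> y x; apply: h2.
- by move=> x; apply: h3.
- by move=> y x; apply: h4.
- by move=> z y x; apply: h5.
- by move=> z y x; apply: h6.
Qed.

(* Main.v *)
Require Import Defs.
From HB Require Import structures.
From mathcomp Require Import all_boot.
From mathcomp Require Import boolp classical_sets functions cardinality.

Set Implicit Arguments.
Unset Strict Implicit.
Unset Printing Implicit Defensive.

Local Open Scope classical_set_scope.

(** Strong amalgamation comes from a representation by points. Over a set [O] of
points with a subset [C], the power set of [O] with union as join and
[Y \sq Z] meaning that every point of [C] in [Y] lies in [Z] is always a
specialization semilattice. Given embeddings [l : S -> A] and [t : S -> B], the
points are the pairs [(I, J)] of ideals of [A] and of [B] that meet [S] in the
same set, and [C] consists of the pairs in which [I] and [J] are also downward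
closed for [\sq]. Sending [a] to the set of the pairs with [a] not in [I], and
[b] to the set of the pairs with [b] not in [J], turns joins into unions, and
the images of an element of [S] in the two ways coincide. There are enough
points: below [a] one takes [I = {x | x <= a}] and
[J = {y | y <= t s for some s with l s <= a}], and likewise with [\sq] for [<=]
(principal_compatible). If [a] and [b] have the same image, these principal
pairs give [s] and [s'] with [l s <= a <= l s'] and [t s' <= b <= t s]; hence
[s = s'], and [a] and [b] are the two images of [s].

Everything else rests on one relation, [same_atomic v w]: the finite tuples [v]
and [w] satisfy the same atomic formulas. It holds exactly when [v] and [w]
correspond under an isomorphism of the submodels that they generate. A term in a
semilattice depends only on its set of variables. Therefore finitely generated
models are finite, and the atomic formulas in [n] variables are finitely many up
to equivalence (finitely_many_atoms).

- If [M] is homogeneous, the truth of [phi] at [v] depends only on which of these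
  finitely many atomic formulas [v] satisfies, so in [M] the formula is equivalent
  to a Boolean combination of them; this is a sentence of the theory of [M], which
  gives quantifier elimination, and with it model completeness.
- By quantifier elimination, the existence of [x] for which the tuple [(x, v)] has
  a prescribed atomic type is a quantifier-free condition on [v]. So any two
  models have the back-and-forth property for [same_atomic], and countable ones
  are isomorphic (back_and_forth).
- A universal sentence true in [M] holds in every specialization semilattice,
  because finitely generated submodels of the latter are finite and so embed
  in [M].

For existence, a countable model [M] is a limit as soon as every tuple of [M] that
matches a tuple of a finite [B] extends to an embedding of [B]: homogeneity is
back_and_forth again. Such an [M] is the union of a chain of finite models with
elements labelled by natural numbers. There are countably many extension problems
up to isomorphism; each is met at arbitrarily late stages of the chain, and solved
there by amalgamation. *)

(** * Embeddings and tuples *)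

Lemma embedding_comp (A B C : structure) (f : A -> B) (g : B -> C) :
  embedding f -> embedding g -> embedding (g \o f).
Proof.
move=> [fi fj fs] [gi gj gs]; split.
- exact: inj_comp.
- by move=> a b /=; rewrite fj gj.
- by move=> a b /=; rewrite fs gs.
Qed.

Lemma embedding_cancel (A B : structure) (f : A -> B) (g : B -> A) :
  embedding f -> cancel g f -> embedding g.
Proof.
move=> [fi fj fs] gK; split.
- exact: can_inj gK.
- by move=> a b; apply: fi; rewrite fj !gK.
- by move=> a b; rewrite fs !gK.
Qed.

Lemma incl_embedding (M : structure) (P : submodel M) :
  embedding (@Defs.incl M P).
Proof.
by split=> // -[a Pa] [b Pb] /= ab; apply: eq_exist.
Qed.

Lemma surjective_bijective (A B : Type) (f : A -> B) :
  injective f -> (forall b, exists a, f a = b) -> bijective f.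
Proof.
move=> fi /choice[g gK]; exists g => // a.
by apply: fi; rewrite gK.
Qed.

Lemma specialization_semilattice_embedding (A B : structure) (f : A -> B) :
  embedding f -> specialization_semilattice B -> specialization_semilattice A.
Proof.
move=> [fi fj fs] [h1 h2 h3 h4 h5 h6]; split.
- by move=> x y z; apply: fi; rewrite !fj h1.
- by move=> x y; apply: fi; rewrite !fj h2.
- by move=> x; apply: fi; rewrite fj h3.
- by move=> a b ab; apply/fs/h4; rewrite /sle -fj ab.
- by move=> a b c /fs ab /fs bc; apply/fs; apply: h5 ab bc.
- by move=> a b c /fs ab /fs cb; apply/fs; rewrite fj; apply: h6.
Qed.

Lemma eval_embedding (A B : structure) (f : A -> B) : embedding f ->
  forall n (v : 'I_n -> A) t, eval (f \o v) t = f (eval v t).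
Proof. by move=> [_ fj _] n v; elim=> //= s -> t ->; rewrite fj. Qed.

Lemma range_finite_tuple (T : Type) (X : set T) :
  finite_set X -> exists n (v : 'I_n -> T), range v = X.
Proof.
move=> /(@finite_seqP {classic T})[s Xs]; exists (size s), (tnth (in_tuple s)).
apply/seteqP; split=> [_ [i _ <-]|x]; rewrite Xs /=; first exact: mem_tnth.
by move=> /(tnthP (in_tuple s))[i ->]; exists i.
Qed.

Lemma gen_closed (M : structure) n (v : 'I_n -> M) :
  join_closed (range (eval v)).
Proof. by move=> _ _ [s _ <-] [t _ <-]; exists (Join s t). Qed.

Definition gen (M : structure) n (v : 'I_n -> M) : submodel M :=
  Submodel (@gen_closed M n v).

Definition gen_eval (M : structure) n (v : 'I_n -> M) (t : term n) : gen v :=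
  exist _ (eval v t) (ex_intro2 _ _ t I erefl).

Lemma gen_eval_surj (M : structure) n (v : 'I_n -> M) (x : gen v) :
  exists t, x = gen_eval v t.
Proof.
have [t _ tx] := svalP x; exists t.
by apply: (emb_inj (@incl_embedding _ (gen v))); rewrite /Defs.incl -tx.
Qed.

Lemma eval_gen (M : structure) n (v : 'I_n -> M) t :
  eval (fun i => gen_eval v (Var i)) t = gen_eval v t.
Proof.
by apply: (emb_inj (@incl_embedding _ (gen v)));
  rewrite -(eval_embedding (@incl_embedding _ (gen v))).
Qed.

Lemma finitely_generatedP (A : structure) :
  finitely_generated A <->
  exists n (v : 'I_n -> A), forall a, exists t, a = eval v t.
Proof.
split=> [[X [/range_finite_tuple[n [v <-]] gX]]|[n [v vs]]].
  exists n, v => a; have : [set: A] a by [].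
  rewrite -gX => /(_ (range (eval v))); case; last by move=> t _ <-; exists t.
  split; first exact: gen_closed.
  by move=> _ [i _ <-]; exists (Var i).
exists (range v); split; first by apply: finite_image.
apply/seteqP; split=> // a _ Y [Yc vY]; have [t ->] := vs a.
by elim: t => [i|s IHs t IHt] /=; [apply: vY; exists i|apply: Yc].
Qed.

Lemma gen_finitely_generated (M : structure) n (v : 'I_n -> M) :
  finitely_generated (gen v).
Proof.
apply/finitely_generatedP; exists n, (fun i => gen_eval v (Var i)) => x.
by have [t ->] := gen_eval_surj x; exists t; rewrite eval_gen.
Qed.

(** * Agreement of tuples on atomic formulas *)

Definition same_atomic (A B : structure) n (v : 'I_n -> A) (w : 'I_n -> B) :=
  forall s t : term n, (eval v s = eval v t <-> eval w s = eval w t) /\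
                       (eval v s \sq eval v t <-> eval w s \sq eval w t).

Lemma same_atomic_sym (A B : structure) n (v : 'I_n -> A) (w : 'I_n -> B) :
  same_atomic v w -> same_atomic w v.
Proof. by move=> vw s t; have [? ?] := vw s t; split; apply: iff_sym. Qed.

Lemma same_atomic_trans (A B C : structure) n (v : 'I_n -> A) (w : 'I_n -> B)
    (u : 'I_n -> C) :
  same_atomic v w -> same_atomic w u -> same_atomic v u.
Proof.
move=> vw wu s t; have [e1 s1] := vw s t; have [e2 s2] := wu s t.
by split; [apply: iff_trans e1 e2|apply: iff_trans s1 s2].
Qed.

Lemma same_atomic_embedding (A B : structure) (f : A -> B) n (v : 'I_n -> A) :
  embedding f -> same_atomic v (f \o v).
Proof.
move=> fe s t; rewrite !eval_embedding //; split; last exact: emb_spec.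
by split=> [->//|]; apply: emb_inj.
Qed.

Lemma term0_absurd : term 0 -> False.
Proof. by elim=> [[]|]. Qed.

Lemma same_atomic0 (A B : structure) (v : 'I_0 -> A) (w : 'I_0 -> B) :
  same_atomic v w.
Proof. by move=> s; case: (term0_absurd s). Qed.

(** Agreement on equations makes [eval v t |-> eval w t] well defined and
    injective. *)
Lemma same_atomic_gen (A B : structure) n (v : 'I_n -> A) (w : 'I_n -> B) :
  same_atomic v w ->
  exists f : gen v -> B, embedding f /\ forall t, f (gen_eval v t) = eval w t.
Proof.
move=> vw.
have /choice[f fE] (x : gen v) :
    exists y, forall t, x = gen_eval v t -> y = eval w t.
  have [s ->] := gen_eval_surj x; exists (eval w s) => t st.
  by apply/(vw s t).1; exact: (congr1 (@Defs.incl _ _) st).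
have {}fE t : f (gen_eval v t) = eval w t by exact: fE.
exists f; split=> //; split.
- move=> x y; have [s ->] := gen_eval_surj x; have [t ->] := gen_eval_surj y.
  rewrite !fE => /(vw s t).1 st.
  exact: (emb_inj (@incl_embedding _ (gen v))).
- move=> x y; have [s ->] := gen_eval_surj x; have [t ->] := gen_eval_surj y.
  rewrite !fE -[RHS]/(eval w (Join s t)) -fE; congr f.
  exact: (emb_inj (@incl_embedding _ (gen v))).
- move=> x y; have [s ->] := gen_eval_surj x; have [t ->] := gen_eval_surj y.
  by rewrite !fE; exact: (vw s t).2.
Qed.

Lemma same_atomic_gen_isomorphism (A B : structure) n (v : 'I_n -> A)
    (w : 'I_n -> B) :
  same_atomic v w ->
  exists f : gen v -> gen w,
    isomorphism f /\ forall t, f (gen_eval v t) = gen_eval w t.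
Proof.
move=> vw; pose w' i := gen_eval w (Var i).
have ww' : same_atomic w w'.
  by apply/same_atomic_sym/(same_atomic_embedding _ (@incl_embedding _ (gen w))).
have [f [fe fE]] := same_atomic_gen (same_atomic_trans vw ww').
have {}fE t : f (gen_eval v t) = gen_eval w t by rewrite fE eval_gen.
exists f; split=> //; split=> //; apply: surjective_bijective (emb_inj fe) _.
by move=> y; have [t ->] := gen_eval_surj y; exists (gen_eval v t).
Qed.

(** * Strong amalgamation *)

Definition ideal (A : structure) (I : A -> Prop) : Prop :=
  forall a b : A, I (a \v b) <-> I a /\ I b.

Definition spec_closed (A : structure) (I : A -> Prop) : Prop :=
  forall a b : A, a \sq b -> I b -> I a.

(** The model in which points separate elements of an arbitrary specialization
    semilattice, one family of points for the order and the subfamily [C] for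
    [\sq]. The carrier is [O -> Prop] and not [set O], whose universe is larger
    than that of carriers. *)
Definition powerset_structure (O : Type) (C : O -> Prop) : structure :=
  @Structure (O -> Prop) (fun Y Z p => Y p \/ Z p)
    (fun Y Z => forall p, C p -> Y p -> Z p).

Lemma powerset_specialization_semilattice (O : Type) (C : O -> Prop) :
  specialization_semilattice (powerset_structure C).
Proof.
split=> /=.
- by move=> X Y Z; apply/funext => p; apply/propext; rewrite /join /=; tauto.
- by move=> X Y; apply/funext => p; apply/propext; rewrite /join /=; tauto.
- by move=> X; apply/funext => p; apply/propext; rewrite /join /=; tauto.
- by move=> X Y <- p _ Xp; left.
- by move=> X Y Z XY YZ p Cp /(XY p Cp); apply: YZ.
- by move=> X Y Z XY ZY p Cp [/(XY p Cp)|/(ZY p Cp)].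
Qed.

Lemma sle_join (S : structure) : specialization_semilattice S ->
  forall a b c : S, sle (a \v b) c <-> sle a c /\ sle b c.
Proof.
move=> [assoc comm idem _ _ _] a b c; rewrite /sle; split=> [<-|[ac bc]].
  split; first by rewrite !assoc idem.
  by rewrite !assoc [b \v a]comm -(assoc a b b) idem.
by rewrite -assoc bc.
Qed.

Lemma sle_refl (S : structure) : specialization_semilattice S ->
  forall a : S, sle a a.
Proof. by move=> [_ _ idem _ _ _] a; apply: idem. Qed.

Lemma sle_trans (S : structure) : specialization_semilattice S ->
  forall a b c : S, sle a b -> sle b c -> sle a c.
Proof. by move=> [assoc _ _ _ _ _] a b c ab bc; rewrite /sle -bc assoc ab. Qed.

Lemma sle_anti (S : structure) : specialization_semilattice S ->
  forall a b : S, sle a b -> sle b a -> a = b.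
Proof. by move=> [_ comm _ _ _ _] a b ab ba; rewrite -ba comm. Qed.

Lemma spec_join (S : structure) : specialization_semilattice S ->
  forall a b c : S, a \v b \sq c <-> a \sq c /\ b \sq c.
Proof.
move=> hS a b c; split=> [abc|[]]; last exact: ss_S3.
have /(sle_join hS)[aab bab] := sle_refl hS (a \v b).
by split; apply: (ss_S2 hS _ abc); apply: ss_S1.
Qed.

Lemma spec_refl (S : structure) : specialization_semilattice S ->
  forall a : S, a \sq a.
Proof. by move=> hS a; apply: ss_S1 => //; apply: sle_refl. Qed.

Lemma sle_embedding (A B : structure) (f : A -> B) : embedding f ->
  forall a b, sle a b <-> sle (f a) (f b).
Proof.
move=> [fi fj _] a b; rewrite /sle -fj; split=> [->//|]; exact: fi.
Qed.

(** An ideal omits [a \v b] iff it omits [a] or omits [b], so sending [a] to the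
    points that omit it turns joins into unions. The principal points separate:
    the one of [b] contains [b], and contains [a] only if [sle a b], respectively
    [a \sq b]. *)
Lemma separating_embedding (A : structure) (O : Type) (C0 C1 : O -> Prop)
    (m : O -> A -> Prop) :
  specialization_semilattice A ->
  (forall p, C1 p -> C0 p) ->
  (forall p, C0 p -> ideal (m p)) ->
  (forall p, C1 p -> spec_closed (m p)) ->
  (forall a, exists2 p, C0 p & m p = fun x => sle x a) ->
  (forall a, exists2 p, C1 p & m p = fun x => x \sq a) ->
  @embedding A (powerset_structure C1) (fun a p => C0 p /\ ~ m p a).
Proof.
move=> hA C10 mI mC sep0 sep1; split.
- have le a b : (fun p => C0 p /\ ~ m p a) = (fun p => C0 p /\ ~ m p b) ->
      sle a b.
    move=> ab; have [p C0p mp] := sep0 b.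
    have := congr1 (@^~ p) ab; rewrite mp /= => abp.
    apply: contrapT => nab; suff [_] : C0 p /\ ~ sle b b by apply; apply: sle_refl.
    by rewrite -abp.
  by move=> a b ab; apply: sle_anti => //; apply: le.
- move=> a b; apply/funext => p; apply/propext; rewrite /join /=.
  split=> [[C0p]|]; first by rewrite mI // not_andE => -[]; [left|right].
  by move=> [] [C0p nm]; split=> //; rewrite mI // => -[].
- move=> a b; split=> [ab p C1p [C0p nma]|abC].
    by split=> //; apply: contra_not nma; apply: (mC _ C1p _ _ ab).
  have [p C1p mp] := sep1 b; apply: contrapT => nab.
  have [] := abC p C1p; first by split; [apply: C10|rewrite mp].
  by rewrite mp => _; apply; apply: spec_refl.
Qed.

Section Amalgam.
Variables (S A B : structure) (l : S -> A) (t : S -> B).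

Definition compatible (p : (A -> Prop) * (B -> Prop)) : Prop :=
  [/\ ideal p.1, ideal p.2 & forall s, p.1 (l s) <-> p.2 (t s)].

Definition compatible_closed (p : (A -> Prop) * (B -> Prop)) : Prop :=
  [/\ compatible p, spec_closed p.1 & spec_closed p.2].

(** Serves for the orders and for the relations [\sq] at once. The least ideal of
    [B] that agrees on [S] with the principal ideal of [a] consists of the
    elements below some [t s] with [l s] below [a]. It is an ideal since these [s]
    are closed under join, and it contains no new element of [S] since the
    relations of [A] and of [B] agree on [S]. *)
Lemma principal_compatible (rA : A -> A -> Prop) (rB : B -> B -> Prop) (a : A) :
  (forall x y z, rA (x \v y) z <-> rA x z /\ rA y z) ->
  (forall x y z, rB (x \v y) z <-> rB x z /\ rB y z) ->
  (forall x y z, rA x y -> rA y z -> rA x z) ->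
  (forall x y z, rB x y -> rB y z -> rB x z) ->
  (forall x, rB x x) ->
  (forall s s', rB (t s) (t s') -> rA (l s) (l s')) ->
  {morph l : x y / x \v y >-> x \v y} -> {morph t : x y / x \v y >-> x \v y} ->
  compatible ((fun x => rA x a), (fun y => exists2 s, rA (l s) a & rB y (t s))).
Proof.
move=> jA jB trA trB reB BA lj tj; split=> /=; first by move=> x y; apply: jA.
- move=> x y; split=> [[s sa /jB[xs ys]]|[[s sa xs] [s' s'a ys']]].
    by split; exists s.
  exists (s \v s'); first by rewrite lj; apply/jA.
  have : rB (t (s \v s')) (t (s \v s')) by [].
  rewrite {1}tj => /jB[ss s's].
  by apply/jB; split; [apply: trB xs ss|apply: trB ys' s's].
- by move=> s; split=> [sa|[s' s'a /BA ss']]; [exists s|apply: trA s'a].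
Qed.

End Amalgam.

Lemma compatible_sym (S A B : structure) (l : S -> A) (t : S -> B) p :
  compatible l t p -> compatible t l (p.2, p.1).
Proof. by move=> [I J IJ]; split=> // s; split=> /(IJ s). Qed.

Section AmalgamEmbedding.
Variables (S A B : structure) (l : S -> A) (t : S -> B).
Hypotheses (hA : specialization_semilattice A).
Hypotheses (hB : specialization_semilattice B).
Hypotheses (le : embedding l) (te : embedding t).

Lemma sle_compatible (a : A) :
  compatible l t
    ((fun x => sle x a), (fun y => exists2 s, sle (l s) a & sle y (t s))).
Proof.
apply: principal_compatible; try exact: emb_join.
- exact: sle_join.
- exact: sle_join.
- exact: sle_trans.
- exact: sle_trans.
- exact: sle_refl.
- by move=> s s' /(sle_embedding te) ss'; apply/(sle_embedding le).
Qed.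

Lemma spec_compatible (a : A) :
  compatible_closed l t
    ((fun x => x \sq a), (fun y => exists2 s, l s \sq a & y \sq t s)).
Proof.
split=> /=; last first.
- by move=> x y xy [s sa ys]; exists s => //; apply: ss_S2 ys.
- by move=> x y; apply: ss_S2.
apply: principal_compatible; try exact: emb_join.
- exact: spec_join.
- exact: spec_join.
- exact: ss_S2.
- exact: ss_S2.
- exact: spec_refl.
- by move=> s s' /(emb_spec te) ss'; apply/(emb_spec le).
Qed.

End AmalgamEmbedding.

(** An element with images from [A] and from [B] is squeezed: applying the equality
    to the principal pairs of [a] and of [b] puts elements of [S] on both sides. *)
Theorem specialization_semilattices_strong_amalgamation :
  strong_amalgamation_property specialization_semilattices.
Proof.
move=> S A B /= hS hA hB l t le te.
pose D := powerset_structure (compatible_closed l t).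
pose l1 (a : A) : D := fun p => compatible l t p /\ ~ p.1 a.
pose t1 (b : B) : D := fun p => compatible l t p /\ ~ p.2 b.
have l1e : embedding l1.
  apply: separating_embedding => //.
  - by move=> p [].
  - by move=> p [].
  - by move=> p [].
  - by move=> a; eexists; first exact: (sle_compatible hA hB le te a).
  - by move=> a; eexists; first exact: (spec_compatible hA hB le te a).
have t1e : embedding t1.
  apply: separating_embedding => //.
  - by move=> p [].
  - by move=> p [].
  - by move=> p [].
  - move=> b; eexists; first exact/compatible_sym/(sle_compatible hB hA te le b).
    by [].
  - move=> b; have [c c1 c2] := spec_compatible hB hA te le b.
    eexists; first by split; first exact: compatible_sym c.
    by [].
have lt : l1 \o l = t1 \o t.
  apply/funext => s; apply/funext => p; apply/propext => /=.
  by split=> -[cp np]; split=> //; have [_ _ ps] := cp; move=> /ps.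
exists D, l1, t1; split=> //; first exact: powerset_specialization_semilattice.
apply/seteqP; split=> [d [[a _ <-] [b _ ab]]|_ [s _ <-]]; last first.
  split; first by exists (l s).
  by exists (t s) => //; rewrite -[LHS]/((t1 \o t) s) -lt.
have [s sa bs] : exists2 s, sle (l s) a & sle b (t s).
  pose p := ((fun x => sle x a),
             (fun y => exists2 s, sle (l s) a & sle y (t s))).
  have cp : compatible l t p by apply: sle_compatible.
  apply: contrapT => nb; have : t1 b p by split.
  by rewrite ab => -[_]; apply; apply: sle_refl.
have [s' s'b as'] : exists2 s, sle (t s) b & sle a (l s).
  pose p := ((fun x => exists2 s, sle (t s) b & sle x (l s)),
             (fun y => sle y b)).
  have cp : compatible l t p.
    exact: (compatible_sym (sle_compatible hB hA te le b)).
  apply: contrapT => na; have : l1 a p by split.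
  by rewrite -ab => -[_]; apply; apply: sle_refl.
have ss' : sle s s' by apply/(sle_embedding le)/(sle_trans hA sa as').
have s's : sle s' s by apply/(sle_embedding te)/(sle_trans hB s'b bs).
exists s => //=; congr l1; apply: (sle_anti hA) => //.
by rewrite (sle_anti hS ss' s's).
Qed.

(** * Finitely generated semilattices are finite *)

HB.instance Definition _ (n : nat) := gen_eqMixin (term n).
HB.instance Definition _ (n : nat) := gen_eqMixin (formula n).

Fixpoint vars (n : nat) (t : term n) : {set 'I_n} :=
  match t with
  | Var i => [set i]%SET
  | Join s t => (vars s :|: vars t)%SET
  end.

Lemma eval_sle (S : structure) : specialization_semilattice S ->
  forall n (v : 'I_n -> S) t x,
    sle (eval v t) x <-> forall i, i \in vars t -> sle (v i) x.
Proof.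
move=> hS n v; elim=> [i|s IHs t IHt] x /=.
  by split=> [vx j /set1P -> //|]; apply; apply: set11.
rewrite sle_join // IHs IHt; split=> [[sx tx] i /setUP[]|stx]; [exact: sx| |].
  exact: tx.
by split=> i ix; apply: stx; rewrite inE ix ?orbT.
Qed.

(** By [eval_sle] the two values have the same upper bounds. *)
Lemma eval_eq_vars (S : structure) : specialization_semilattice S ->
  forall n (v : 'I_n -> S) s t, vars s = vars t -> eval v s = eval v t.
Proof.
move=> hS n v s t st; apply: (sle_anti hS); apply/(eval_sle hS) => i.
  by rewrite st => it; apply: (eval_sle hS _ _ _).1 it; apply: sle_refl.
by rewrite -st => it; apply: (eval_sle hS _ _ _).1 it; apply: sle_refl.
Qed.

Lemma term_representatives (n : nat) :
  exists T : seq (term n), forall t, exists2 t', t' \in T & vars t' = vars t.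
Proof.
suff [T TP] : exists T : seq (term n), forall t, vars t \in enum {set 'I_n} ->
    exists2 t', t' \in T & vars t' = vars t.
  by exists T => t; apply: TP; rewrite mem_enum.
elim: (enum _) => [|X Xs [T TP]]; first by exists [::].
have [[t0 <-]|noX] := pselect (exists t : term n, vars t = X).
  exists (t0 :: T) => t; rewrite inE => /orP[/eqP tt0|/TP[t' t'T t't]].
    by exists t0; rewrite ?mem_head.
  by exists t' => //; rewrite inE t'T orbT.
exists T => t; rewrite inE => /orP[/eqP tX|]; last exact: TP.
by case: noX; exists t.
Qed.

Lemma finitely_generated_finite (A : structure) :
  specialization_semilattice A -> finitely_generated A -> finite_structure A.
Proof.
move=> hA /finitely_generatedP[n [v vs]]; have [T TP] := term_representatives n.
apply: (@sub_finite_set _ _ (eval v @` [set` T])).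
  move=> a _; have [t ->] := vs a; have [t' t'T t't] := TP t.
  by exists t' => //; apply: eval_eq_vars.
exact/finite_image/finite_seq.
Qed.

Lemma finite_finitely_generated (A : structure) :
  finite_structure A -> finitely_generated A.
Proof.
move=> /range_finite_tuple[n [v vA]]; apply/finitely_generatedP; exists n, v => a.
have : [set: A] a by [].
by rewrite -vA => -[i _ <-]; exists (Var i).
Qed.

(** * Quantifier-free formulas *)

Definition Neg n (phi : formula n) : formula n := Imp phi Bot.
Definition Conj n (phi psi : formula n) : formula n :=
  Neg (Imp phi (Neg psi)).
Definition Iff n (phi psi : formula n) : formula n :=
  Conj (Imp phi psi) (Imp psi phi).
Definition Exi n (phi : formula n.+1) : formula n := Neg (All (Neg phi)).

Section Sat.
Variables (M : structure) (n : nat) (v : 'I_n -> M).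

Lemma sat_Conj phi psi : sat (Conj phi psi) v <-> sat phi v /\ sat psi v.
Proof. by rewrite /=; split=> [/not_implyP[? /contrapT]|[? ?]] //; exact. Qed.

Lemma sat_Iff phi psi : sat (Iff phi psi) v <-> (sat phi v <-> sat psi v).
Proof. by rewrite sat_Conj. Qed.

Lemma sat_Exi phi : sat (Exi phi) v <-> exists x, sat phi (scons x v).
Proof.
rewrite /=; split=> [/existsNP[x /contrapT]|[x px] np]; first by exists x.
exact: np px.
Qed.

End Sat.

Lemma scons_lift (T : Type) n (x : T) (v : 'I_n -> T) :
  scons x v \o lift ord0 = v.
Proof. by apply/funext => -[k lt_k] /=; congr v; apply: val_inj. Qed.

Lemma scons_eta (T : Type) n (v : 'I_n.+1 -> T) :
  scons (v ord0) (v \o lift ord0) = v.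
Proof. by apply/funext => -[[|k] lt_k] /=; congr v; apply: val_inj. Qed.

Lemma comp_scons (A B : Type) (f : A -> B) n (x : A) (v : 'I_n -> A) :
  f \o scons x v = scons (f x) (f \o v).
Proof. by apply/funext => -[[|k] lt_k]. Qed.

Lemma holds_universal_closure (M : structure) n (phi : formula n) :
  holds M (universal_closure phi) <-> forall v : 'I_n -> M, sat phi v.
Proof.
elim: n => [|n IHn] in phi *.
  split=> [h v|]; last exact.
  by rewrite (_ : v = @no_var M)//; apply/funext => -[].
rewrite /= IHn; split=> h v; last by move=> x; apply: h.
by rewrite -(scons_eta v); apply: h.
Qed.

Lemma sat_isomorphism (A B : structure) (f : A -> B) : isomorphism f ->
  elementary f.
Proof.
move=> [fe [g fK gK]] n phi; elim: phi => {n} //=.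
- by move=> n s t v; rewrite !eval_embedding //; split=> [->//|/(emb_inj fe)].
- by move=> n s t v; rewrite !eval_embedding //; apply: emb_spec.
- by move=> n phi IHphi psi IHpsi v; rewrite IHphi IHpsi.
- move=> n phi IHphi v; split=> h x; last by rewrite IHphi comp_scons; apply: h.
  by rewrite -(gK x) -comp_scons -IHphi.
Qed.

Lemma quantifier_free_same_atomic n (phi : formula n) : quantifier_free phi ->
  forall (A B : structure) (v : 'I_n -> A) (w : 'I_n -> B),
  same_atomic v w -> (sat phi v <-> sat phi w).
Proof.
elim: phi => {n} //=.
- by move=> n s t _ A B v w vw; exact: (vw s t).1.
- by move=> n s t _ A B v w vw; exact: (vw s t).2.
- move=> n phi IHphi psi IHpsi /andP[qphi qpsi] A B v w vw.
  by rewrite (IHphi qphi _ _ _ _ vw) (IHpsi qpsi _ _ _ _ vw).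
Qed.

Definition agree (A B : structure) n (L : seq (formula n))
    (v : 'I_n -> A) (w : 'I_n -> B) : Prop :=
  forall chi, chi \in L -> (sat chi v <-> sat chi w).

(** Equations and [\sq]-formulas between representatives of the terms suffice. *)
Lemma finitely_many_atoms (n : nat) : exists2 L : seq (formula n),
  {in L, forall chi, quantifier_free chi} &
  forall A B : structure,
    specialization_semilattice A -> specialization_semilattice B ->
    forall (v : 'I_n -> A) (w : 'I_n -> B), agree L v w -> same_atomic v w.
Proof.
have [T TP] := term_representatives n.
exists ([seq Eq s t | s <- T, t <- T] ++ [seq Spec s t | s <- T, t <- T]).
  by move=> chi; rewrite mem_cat => /orP[] /allpairsP[[s t] [_ _ ->]].
move=> A B hA hB v w vw s t.
have [s' s'T /esym ss'] := TP s; have [t' t'T /esym tt'] := TP t.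
rewrite !(eval_eq_vars hA v ss') !(eval_eq_vars hA v tt').
rewrite !(eval_eq_vars hB w ss') !(eval_eq_vars hB w tt').
split; [apply: (vw (Eq s' t'))|apply: (vw (Spec s' t'))].
  by rewrite mem_cat allpairs_f.
by rewrite mem_cat allpairs_f ?orbT.
Qed.

(** Induction on [L], by cases on whether its first formula [chi] holds: on each
    side, [P] is replaced by the predicate saying that some tuple on that side
    which agrees on the rest of [L] satisfies [P]. *)
Lemma boolean_combination (M : structure) n (L : seq (formula n))
    (P : ('I_n -> M) -> Prop) :
  {in L, forall chi, quantifier_free chi} ->
  (forall v w, agree L v w -> P v -> P w) ->
  exists2 psi : formula n,
    quantifier_free psi & forall v, P v <-> sat psi v.
Proof.
elim: L => [|chi L IHL] in P * => qL PL.
  have [[v Pv]|nP] := pselect (exists v, P v).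
    by exists (Neg Bot) => // w; split=> _; [case|apply: (PL v)].
  by exists Bot => // v; split=> //= Pv; apply: nP; exists v.
(* [Q b v]: some tuple that agrees with [v] on [L], and at which [chi] has truth
   value [b], satisfies [P]. *)
pose Q (b : Prop) (v : 'I_n -> M) :=
  exists2 w, agree L w v & (sat chi w <-> b) /\ P w.
have QL b : exists2 psi : formula n,
    quantifier_free psi & forall v, Q b v <-> sat psi v.
  apply: IHL => [xi xiL|v w vw [u uv Pu]]; first by rewrite qL // inE xiL orbT.
  by exists u => // xi xiL; rewrite uv // vw.
have [psi1 q1 psi1P] := QL True; have [psi0 q0 psi0P] := QL False.
exists (Conj (Imp chi psi1) (Imp (Neg chi) psi0)).
  by rewrite /= q1 q0 qL ?mem_head.
have PQ v b : (sat chi v <-> b) -> (P v <-> Q b v).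
  move=> vb; split=> [Pv|[w wv [wb Pw]]]; first by exists v.
  apply: (PL w) => // xi; rewrite inE => /orP[/eqP ->|]; last exact: wv.
  by rewrite wb vb.
move=> v; rewrite sat_Conj /= -psi1P -psi0P.
have [cv|ncv] := pselect (sat chi v).
  by rewrite (PQ v True) //; split=> [Qv|[+ _]]; [split|apply].
by rewrite (PQ v False) //; split=> [Qv|[_]]; [split|apply].
Qed.

(** The conjunction of the finitely many literals true at [v]. *)
Lemma isolating_formula (A : structure) n (v : 'I_n -> A) :
  specialization_semilattice A ->
  exists2 theta : formula n, sat theta v &
    forall (B : structure) (w : 'I_n -> B),
      specialization_semilattice B -> sat theta w -> same_atomic v w.
Proof.
move=> hA; have [L _ LP] := finitely_many_atoms n.
suff [theta vtheta thetaP] : exists2 theta : formula n, sat theta v &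
    forall (B : structure) (w : 'I_n -> B), sat theta w -> agree L v w.
  by exists theta => // B w hB tw; apply: LP => //; apply: thetaP.
elim: L {LP} => [|chi L [theta vtheta thetaP]]; first by exists (Neg Bot).
have [cv|ncv] := pselect (sat chi v).
  exists (Conj chi theta); first exact/sat_Conj.
  move=> B w /sat_Conj[cw tw] xi; rewrite inE => /orP[/eqP ->|]; first by split.
  exact: thetaP.
exists (Conj (Neg chi) theta); first exact/sat_Conj.
move=> B w /sat_Conj[cw tw] xi; rewrite inE => /orP[/eqP ->|].
  by split=> [/ncv|/cw].
exact: thetaP.
Qed.

(** * Back and forth *)

Definition extends_atomically (A B : structure) : Prop :=
  forall n (v : 'I_n -> A) (w : 'I_n -> B), same_atomic v w ->
  forall a, exists b, same_atomic (scons a v) (scons b w).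

Section BackAndForth.
Variables A B : structure.

(** A finite partial isomorphism, presented by a pair of generating tuples; the
    order [match_le] below compares only the pairs of elements they match, so that
    no reindexing of tuples is needed. *)
Record partial_match := PartialMatch {
  dim : nat;
  left_tuple : 'I_dim -> A;
  right_tuple : 'I_dim -> B;
  match_atomic : same_atomic left_tuple right_tuple
}.

Arguments left_tuple : clear implicits.
Arguments right_tuple : clear implicits.
Arguments match_atomic : clear implicits.

Definition matches (s : partial_match) (a : A) (b : B) : Prop :=
  exists2 i, left_tuple s i = a & right_tuple s i = b.

Definition match_le (s s' : partial_match) : Prop :=
  forall a b, matches s a b -> matches s' a b.

Lemma match_extend (s : partial_match) a b :
  same_atomic (scons a (left_tuple s)) (scons b (right_tuple s)) ->
  exists2 s', match_le s s' & matches s' a b.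
Proof.
move=> sab; exists (PartialMatch sab); last by exists ord0.
move=> _ _ [i <- <-]; exists (lift ord0 i) => /=.
  by rewrite -[RHS](congr1 (@^~ i) (scons_lift a (left_tuple s))).
by rewrite -[RHS](congr1 (@^~ i) (scons_lift b (right_tuple s))).
Qed.

Lemma matches_join s a b a1 b1 a2 b2 :
  matches s a b -> matches s a1 b1 -> matches s a2 b2 ->
  (a1 \v a2 = a <-> b1 \v b2 = b).
Proof.
move=> [i <- <-] [i1 <- <-] [i2 <- <-].
exact: (match_atomic s (Join (Var i1) (Var i2)) (Var i)).1.
Qed.

Lemma matches_eq s a b a1 b1 : matches s a b -> matches s a1 b1 ->
  (a = a1 <-> b = b1).
Proof.
move=> [i <- <-] [i1 <- <-].
exact: (match_atomic s (Var i) (Var i1)).1.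
Qed.

Lemma matches_spec s a b a1 b1 : matches s a b -> matches s a1 b1 ->
  (a \sq a1 <-> b \sq b1).
Proof.
move=> [i <- <-] [i1 <- <-].
exact: (match_atomic s (Var i) (Var i1)).2.
Qed.

(** At step [k] the elements of [A] and of [B] numbered [k] receive partners. The
    union of the matches obtained is the graph of the isomorphism, as any three
    matched pairs already occur together at some step. *)
Theorem back_and_forth :
  countable_structure A -> countable_structure B ->
  extends_atomically A B -> extends_atomically B A ->
  forall n (v : 'I_n -> A) (w : 'I_n -> B), same_atomic v w ->
  exists2 g : A -> B, isomorphism g & g \o v = w.
Proof.
move=> /countable_injP[hA hAi] /countable_injP[hB hBi] forth back n v w vw.
have {}hAi : injective hA by move=> a a'; apply: hAi; rewrite inE.
have {}hBi : injective hB by move=> b b'; apply: hBi; rewrite inE.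
have go_forth s k : exists2 s', match_le s s' &
    forall a, hA a = k -> exists b, matches s' a b.
  have [[a ak]|na] := pselect (exists a, hA a = k); last first.
    by exists s => // a ak; case: na; exists a.
  have [b sab] := forth _ _ _ (match_atomic s) a.
  have [s' ss' s'ab] := match_extend sab; exists s' => // a'.
  by rewrite -ak => /hAi ->; exists b.
have go_back s k : exists2 s', match_le s s' &
    forall b, hB b = k -> exists a, matches s' a b.
  have [[b bk]|nb] := pselect (exists b, hB b = k); last first.
    by exists s => // b bk; case: nb; exists b.
  have [a sba] :=
    back _ _ _ (same_atomic_sym (match_atomic s)) b.
  have [s' ss' s'ab] := match_extend (same_atomic_sym sba); exists s' => // b'.
  by rewrite -bk => /hBi ->; exists a.
have /choice[next nextP] (sk : partial_match * nat) : exists s',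
    [/\ match_le sk.1 s', forall a, hA a = sk.2 -> exists b, matches s' a b
      & forall b, hB b = sk.2 -> exists a, matches s' a b].
  have [s1 le1 fo1] := go_forth sk.1 sk.2; have [s2 le2 ba2] := go_back s1 sk.2.
  exists s2; split=> // [a b /le1/le2//|a /fo1[b /le2 m]]; by exists b.
pose S := fix S k := if k is k'.+1 then next (S k', k') else PartialMatch vw.
have S_le j k : j <= k -> match_le (S j) (S k).
  elim: k => [|k IHk]; first by rewrite leqn0 => /eqP ->.
  rewrite leq_eqVlt => /predU1P[-> //|/IHk jk] a b /jk.
  by have [+ _ _] := nextP (S k, k); apply.
(* [R] is the graph of the isomorphism [g] under construction. *)
pose R a b := exists k, matches (S k) a b.
have /choice[g gR] (a : A) : exists b, R a b.
  have [_ + _] := nextP (S (hA a), hA a) => /(_ a erefl)[b m].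
  by exists b, (hA a).+1.
have joint a b a1 b1 a2 b2 : R a b -> R a1 b1 -> R a2 b2 -> exists k,
    [/\ matches (S k) a b, matches (S k) a1 b1 & matches (S k) a2 b2].
  move=> [k m] [k1 m1] [k2 m2]; exists (maxn k (maxn k1 k2)).
  by split; [apply: S_le m|apply: S_le m1|apply: S_le m2];
    rewrite !leq_max leqnn ?orbT.
have gE a b : R a b -> g a = b.
  move=> Rab; have [k [m m' _]] := joint _ _ _ _ _ _ (gR a) Rab Rab.
  exact/(matches_eq m m').
exists g; last first.
  by apply/funext => i; apply: gE; exists 0, i.
have gi : injective g.
  move=> a a' aa'; have [k [m m' _]] := joint _ _ _ _ _ _ (gR a) (gR a') (gR a).
  exact/(matches_eq m m').
split.
  split=> // a a'.
    have [k [m m1 m2]] := joint _ _ _ _ _ _ (gR (a \v a')) (gR a) (gR a').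
    exact/esym/(matches_join m m1 m2).
  have [k [m m1 _]] := joint _ _ _ _ _ _ (gR a) (gR a') (gR a).
  exact: matches_spec m m1.
apply: surjective_bijective gi _ => b.
have [_ _ /(_ b erefl)[a m]] := nextP (S (hB b), hB b).
by exists a; apply: gE; exists (hB b).+1.
Qed.

End BackAndForth.

(** * The theory of a homogeneous model *)

(** The axioms have at most three variables. *)
Lemma specialization_semilattice_local (M : structure) :
  (forall v : 'I_3 -> M, specialization_semilattice (gen v)) ->
  specialization_semilattice M.
Proof.
move=> hM.
have gen3 (a b c : M) : exists v : 'I_3 -> M, exists x y z : gen v,
    [/\ Defs.incl x = a, Defs.incl y = b & Defs.incl z = c].
  pose v := scons a (scons b (scons c (@no_var M))); exists v.
  by exists (gen_eval v (Var ord0)), (gen_eval v (Var (lift ord0 ord0))),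
    (gen_eval v (Var (lift ord0 (lift ord0 ord0)))).
split.
- move=> a b c; have [v [x [y [z [<- <- <-]]]]] := gen3 a b c.
  by have := congr1 (@Defs.incl _ (gen v)) (ss_assoc (hM v) x y z).
- move=> a b; have [v [x [y [_ [<- <- _]]]]] := gen3 a b a.
  by have := congr1 (@Defs.incl _ (gen v)) (ss_comm (hM v) x y).
- move=> a; have [v [x [_ [_ [<- _ _]]]]] := gen3 a a a.
  by have := congr1 (@Defs.incl _ (gen v)) (ss_idem (hM v) x).
- move=> a b; have [v [x [y [_ [<- <- _]]]]] := gen3 a b a => xy.
  exact: (ss_S1 (hM v) ((sle_embedding (incl_embedding _) x y).2 xy)).
- move=> a b c; have [v [x [y [z [<- <- <-]]]]] := gen3 a b c.
  exact: (@ss_S2 _ (hM v) x y z).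
- move=> a b c; have [v [x [y [z [<- <- <-]]]]] := gen3 a b c.
  exact: (@ss_S3 _ (hM v) x y z).
Qed.

Lemma theory_of_model (T : theory) (M N : structure) :
  model_of T M -> model_of (theory_of M) N -> model_of T N.
Proof. by move=> TM MN phi /TM; apply: MN. Qed.

Lemma same_atomic_automorphism (M : structure) : homogeneous M ->
  forall n (v w : 'I_n -> M), same_atomic v w ->
  exists2 g : M -> M, isomorphism g & g \o v = w.
Proof.
move=> homM n v w /same_atomic_gen_isomorphism[f [fI fE]].
have [g [gI gf]] := homM _ _ (gen_finitely_generated v)
  (gen_finitely_generated w) f fI.
exists g => //; apply/funext => i.
by have := gf (gen_eval v (Var i)); rewrite fE.
Qed.

Lemma homogeneous_quantifier_elimination (M : structure) :
  specialization_semilattice M -> homogeneous M ->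
  quantifier_elimination (theory_of M).
Proof.
move=> hM homM n phi; have [L qL LP] := finitely_many_atoms n.
have [v w vw pv|psi qpsi psiP] := @boolean_combination M n L (sat phi) qL.
  have [g gI <-] := same_atomic_automorphism homM (LP _ _ hM hM _ _ vw).
  exact: (sat_isomorphism gI phi v).1.
exists psi; split=> // N v NM; apply/sat_Iff; move: v.
apply/holds_universal_closure/NM/holds_universal_closure => v.
exact/sat_Iff.
Qed.

Lemma quantifier_elimination_model_complete (T : theory) :
  quantifier_elimination T -> model_complete T.
Proof.
move=> qeT A B TA TB f fe n phi v; have [psi [qpsi psiP]] := qeT n phi.
rewrite (psiP A v TA) (psiP B _ TB).
exact/quantifier_free_same_atomic/same_atomic_embedding.
Qed.

(** The formula isolating the atomic type of [scons a v], with its first variable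
    existentially quantified, is equivalent to a quantifier-free formula, hence
    passes from [v] to [w]. *)
Lemma quantifier_elimination_extends_atomically (T : theory) (A B : structure) :
  quantifier_elimination T -> model_of T A -> model_of T B ->
  specialization_semilattice A -> specialization_semilattice B ->
  extends_atomically A B.
Proof.
move=> qeT TA TB hA hB n v w vw a.
have [theta ta thetaP] := isolating_formula (scons a v) hA.
have [psi [qpsi psiP]] := qeT n (Exi theta).
have : sat (Exi theta) w.
  rewrite (psiP B w TB) -(quantifier_free_same_atomic qpsi vw) -(psiP A v TA).
  by apply/sat_Exi; exists a.
by move=> /sat_Exi[b tb]; exists b; apply: thetaP.
Qed.

Lemma quantifier_elimination_omega_categorical (T : theory) :
  quantifier_elimination T -> models T `<=` specialization_semilattices ->
  omega_categorical T.
Proof.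
move=> qeT hT A B TA TB cA cB.
have hA : specialization_semilattice A := hT A TA.
have hB : specialization_semilattice B := hT B TB.
have countable_infinite C : countably_infinite C -> countable_structure C.
  by rewrite /countably_infinite card_eq_le => /andP[].
have [||||g gI _] := @back_and_forth A B _ _ _ _ 0 _ _
  (same_atomic0 (@no_var A) (@no_var B)); last by exists g.
- exact: countable_infinite.
- exact: countable_infinite.
- exact: quantifier_elimination_extends_atomically.
- exact: quantifier_elimination_extends_atomically.
Qed.

Lemma universal_consequence_transfer (phi : sentence) (S M : structure) :
  universal_sentence phi ->
  (forall n (v : 'I_n -> S), exists w : 'I_n -> M, same_atomic v w) ->
  holds M phi -> holds S phi.
Proof.
move=> [n [psi [qpsi ->]]] SM /holds_universal_closure Mpsi.
apply/holds_universal_closure => v; have [w vw] := SM n v.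
exact/(quantifier_free_same_atomic qpsi vw).
Qed.

Section FraisseLimit.
Variable M : structure.
Hypothesis limM : fraisse_limit finite_specialization_semilattices M.

Lemma fraisse_limit_specialization_semilattice : specialization_semilattice M.
Proof.
have [_ _ ageM] := limM; apply: specialization_semilattice_local => v.
have : age M (gen v).
  split; first exact: gen_finitely_generated.
  by exists (@Defs.incl _ (gen v)); apply: incl_embedding.
by rewrite ageM => -[].
Qed.

Lemma fraisse_limit_theory_models :
  models (theory_of M) `<=` specialization_semilattices.
Proof.
move=> N NM; rewrite -models_specialization_semilattice_theory.
apply: theory_of_model NM.
rewrite -[model_of _ _]/(models specialization_semilattice_theory M).
rewrite models_specialization_semilattice_theory.
exact: fraisse_limit_specialization_semilattice.
Qed.

Lemma fraisse_limit_atomically_universal (S : structure) :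
  specialization_semilattice S ->
  forall n (v : 'I_n -> S), exists w : 'I_n -> M, same_atomic v w.
Proof.
move=> hS n v; have [_ _ ageM] := limM.
have hv : specialization_semilattice (gen v).
  exact: specialization_semilattice_embedding (incl_embedding _) hS.
have : finite_specialization_semilattices (gen v).
  split=> //; apply: finitely_generated_finite => //.
  exact: gen_finitely_generated.
rewrite -ageM => -[_ [f fe]]; exists (f \o fun i => gen_eval v (Var i)).
apply: same_atomic_trans (same_atomic_embedding _ fe).
exact/same_atomic_sym/(same_atomic_embedding _ (incl_embedding _)).
Qed.

Theorem fraisse_limit_model_theory :
  [/\ omega_categorical (theory_of M), quantifier_elimination (theory_of M)
    & model_completion (theory_of M) specialization_semilattice_theory].
Proof.
have hM := fraisse_limit_specialization_semilattice.
have [_ homM _] := limM.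
have qe := homogeneous_quantifier_elimination hM homM.
split=> //.
  exact: quantifier_elimination_omega_categorical fraisse_limit_theory_models.
split.
- move=> phi uphi; split=> [Tphi N /fraisse_limit_theory_models|Mphi N].
    rewrite -models_specialization_semilattice_theory; exact: Tphi.
  rewrite -[model_of _ _]/(models specialization_semilattice_theory N).
  rewrite models_specialization_semilattice_theory => hN.
  apply: (universal_consequence_transfer uphi (M := M)).
    exact: fraisse_limit_atomically_universal.
  exact: Mphi.
- rewrite models_specialization_semilattice_theory => S A B hS hA hB l t le te.
  have [D [l1 [t1 [hD l1e t1e lt _]]]] :=
    specialization_semilattices_strong_amalgamation hS hA hB le te.
  by exists D, l1, t1.
- exact: quantifier_elimination_model_complete.
Qed.

End FraisseLimit.

(** * A criterion for being a limit *)

(** Injectivity of [M] for the inclusions [gen v -> B] into finite models. *)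
Definition finitely_injective (M : structure) : Prop :=
  forall B : structure, finite_specialization_semilattices B ->
  forall n (v : 'I_n -> B) (w : 'I_n -> M), same_atomic v w ->
  exists2 f : B -> M, embedding f & f \o v = w.

(** Applied to the finite submodel [B] generated by [v] and [a], with [v] as the
    tuple to be sent to [w]. *)
Lemma finitely_injective_extends (M : structure) :
  specialization_semilattice M -> finitely_injective M ->
  extends_atomically M M.
Proof.
move=> hM injM n v w vw a; pose B := gen (scons a v).
have iB : embedding (@Defs.incl _ B) by apply: incl_embedding.
have hB : specialization_semilattice B.
  exact: specialization_semilattice_embedding iB hM.
pose x i : B := gen_eval (scons a v) (Var i).
have xw : same_atomic (x \o lift ord0) w.
  apply: same_atomic_trans vw; rewrite -[v in same_atomic _ v](scons_lift a v).
  exact: same_atomic_embedding iB.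
have [|f fe fw] := injM B _ n _ w xw.
  split=> //; apply: finitely_generated_finite => //.
  exact: gen_finitely_generated.
exists (f (x ord0)); rewrite -fw -comp_scons scons_eta.
apply: same_atomic_trans (same_atomic_embedding x fe).
exact/same_atomic_sym/(same_atomic_embedding x iB).
Qed.

Lemma finitely_injective_fraisse_limit (M : structure) :
  countable_structure M -> specialization_semilattice M ->
  finitely_injective M ->
  fraisse_limit finite_specialization_semilattices M.
Proof.
move=> cM hM injM; have extM := finitely_injective_extends hM injM.
split=> //.
- move=> P Q /finitely_generatedP[n [v vs]] _ f [fe _].
  pose v1 := @Defs.incl _ P \o v; pose v2 := @Defs.incl _ Q \o (f \o v).
  have v12 : same_atomic v1 v2.
    apply: (same_atomic_trans (w := v)).
      exact/same_atomic_sym/same_atomic_embedding/incl_embedding.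
    apply: same_atomic_trans (same_atomic_embedding _ fe) _.
    exact/same_atomic_embedding/incl_embedding.
  have [g gI gv] := back_and_forth cM cM extM extM v12.
  exists g; split=> // x; have [t ->] := vs x.
  rewrite -(eval_embedding (@incl_embedding _ P)) -(eval_embedding gI.1) gv.
  by rewrite -(eval_embedding fe) -(eval_embedding (@incl_embedding _ Q)).
- apply/seteqP; split=> [A [fgA [f fe]]|A fA].
    have hA : specialization_semilattice A.
      exact: specialization_semilattice_embedding fe hM.
    by split=> //; apply: finitely_generated_finite.
  split; first by apply: finite_finitely_generated; case: fA.
  have [f fe _] := injM A fA 0 (@no_var A) (@no_var M) (same_atomic0 _ _).
  by exists f.
Qed.

(** * Finite labelled stages *)

(** Labels make the members of a chain overlap literally in [nat], so the union
    of the chain is a set of labels and no quotient is needed. *)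
Record stage := Stage {
  stage_structure :> structure;
  label : stage_structure -> nat;
  stage_finite : finite_specialization_semilattices stage_structure;
  label_inj : injective label
}.

Arguments label : clear implicits.

Definition stage_le (s s' : stage) : Prop :=
  exists2 e : s -> s', embedding e & label s' \o e = label s.

Lemma stage_le_refl s : stage_le s s.
Proof. by exists id => //; split. Qed.

Lemma stage_le_trans s1 s2 s3 :
  stage_le s1 s2 -> stage_le s2 s3 -> stage_le s1 s3.
Proof.
move=> [e ee el] [f fe fl]; exists (f \o e); first exact: embedding_comp.
by rewrite compA fl el.
Qed.

Lemma embedding_corestrict (A D : structure) (P : submodel D) (f : A -> D) :
  embedding f -> (forall a, submodel_set P (f a)) ->
  exists2 f' : A -> P, embedding f' & @Defs.incl _ P \o f' = f.
Proof.
move=> [fi fj fs] fP; pose f' a : P := exist _ (f a) (fP a).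
have ie := @incl_embedding _ P.
exists f' => //; split.
- by move=> a b /(congr1 (@Defs.incl _ P)); apply: fi.
- by move=> a b; apply: (emb_inj ie); rewrite (emb_join ie); apply: fj.
- by move=> a b; rewrite fs.
Qed.

(** An amalgam may be infinite, but the submodel generated by the images of two
    finite models is finite. *)
Lemma finite_amalgamation :
  amalgamation_property finite_specialization_semilattices.
Proof.
move=> S A B [hS fS] [hA fA] [hB fB] l t le te.
have [D [l1 [t1 [hD l1e t1e lt _]]]] :=
  specialization_semilattices_strong_amalgamation hS hA hB le te.
have [p [x xA]] := range_finite_tuple fA.
have [q [y yB]] := range_finite_tuple fB.
pose z (i : 'I_(p + q)) : D :=
  match fintype.split i with inl j => l1 (x j) | inr j => t1 (y j) end.
have z_l1 a : submodel_set (gen z) (l1 a).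
  have : [set: A] a by [].
  rewrite -xA => -[j _ <-]; exists (Var (unsplit (inl j))) => //.
  by rewrite -[LHS]/(z (unsplit (inl j))) /z unsplitK.
have z_t1 b : submodel_set (gen z) (t1 b).
  have : [set: B] b by [].
  rewrite -yB => -[j _ <-]; exists (Var (unsplit (inr j))) => //.
  by rewrite -[LHS]/(z (unsplit (inr j))) /z unsplitK.
have [l2 l2e l2E] := embedding_corestrict l1e z_l1.
have [t2 t2e t2E] := embedding_corestrict t1e z_t1.
have iz := @incl_embedding _ (gen z).
exists (gen z), l2, t2; split=> //.
  have hz : specialization_semilattice (gen z).
    exact: specialization_semilattice_embedding iz hD.
  by split=> //; apply/finitely_generated_finite/gen_finitely_generated.
apply/funext => s; apply: (emb_inj iz).
by have := congr1 (@^~ s) lt; rewrite -l2E -t2E.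
Qed.

(** Elements outside the image of [s] get labels above the bound [N] of the labels
    of [s]. *)
Lemma relabel (s : stage) (D : structure) (e : s -> D) :
  finite_specialization_semilattices D -> embedding e ->
  exists2 g : D -> nat, injective g & g \o e = label s.
Proof.
move=> [hD fD] ee.
have /countable_injP[h hi] := finite_set_countable fD.
have {}hi : injective h by move=> a b; apply: hi; rewrite inE.
have [n [x xs]] := range_finite_tuple (stage_finite s).2.
pose N := (\max_(i < n) label s (x i)).+1.
have ltN a : label s a < N.
  have : [set: s] a by [].
  by rewrite -xs => -[i _ <-]; apply: (leq_bigmax (F := fun i => label s (x i))).
have /choice[g gP] (d : D) : exists k,
    (exists2 a, e a = d & k = label s a) \/
    ((forall a, e a <> d) /\ k = N + h d).
  have [[a ad]|na] := pselect (exists a, e a = d).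
    by exists (label s a); left; exists a.
  by exists (N + h d); right; split=> // a ad; apply: na; exists a.
exists g.
  move=> d d'; case: (gP d) => [[a <- ->]|[_ ->]];
    case: (gP d') => [[a' <- ->]|[_ ->]].
  - by move=> /label_inj ->.
  - by move=> aN; have := ltN a; rewrite aN ltnNge leq_addr.
  - by move=> aN; have := ltN a'; rewrite -aN ltnNge leq_addr.
  - by move=> /addnI/hi.
apply/funext => a /=; case: (gP (e a)) => [[a' /(emb_inj ee) -> ->]|[na _]] //.
by case: (na a).
Qed.

(** Amalgamation of [s] and [B] over the submodel generated by [v], which [u]
    embeds in [s]. *)
Lemma stage_extend (s : stage) (B : structure) n (v : 'I_n -> B)
    (u : 'I_n -> s) :
  finite_specialization_semilattices B -> same_atomic v u ->
  exists2 s', stage_le s s' &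
    exists2 f : B -> s', embedding f & label s' \o f \o v = label s \o u.
Proof.
move=> fB vu; have [f0 [f0e f0E]] := same_atomic_gen vu.
have iv := @incl_embedding _ (gen v).
have hv : specialization_semilattice (gen v).
  exact: specialization_semilattice_embedding iv fB.1.
have fv : finite_specialization_semilattices (gen v).
  by split=> //; apply/finitely_generated_finite/gen_finitely_generated.
have [D [e [f [fD ee fe ef]]]] :=
  finite_amalgamation fv (stage_finite s) fB f0e iv.
have [g gi ge] := relabel fD ee.
exists (Stage fD gi); first by exists e.
exists f => //; rewrite -ge; apply/funext => i /=; congr g.
by have := congr1 (@^~ (gen_eval v (Var i))) ef; rewrite /= f0E.
Qed.

(** * The union of a chain of stages *)

Section Union.
Variable S : nat -> stage.
Hypothesis S_succ : forall k, stage_le (S k) (S k.+1).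

Lemma chain_le j k : j <= k -> stage_le (S j) (S k).
Proof.
elim: k => [|k IHk]; first by rewrite leqn0 => /eqP ->; apply: stage_le_refl.
rewrite leq_eqVlt => /predU1P[->|/IHk jk]; first exact: stage_le_refl.
exact: stage_le_trans jk (S_succ k).
Qed.

Lemma chain_coherent j k (a b : S j) (a' b' : S k) :
  label (S j) a = label (S k) a' -> label (S j) b = label (S k) b' ->
  label (S j) (a \v b) = label (S k) (a' \v b') /\ (a \sq b <-> a' \sq b').
Proof.
have [e [_ ej es] el] := chain_le (leq_maxl j k).
have [f [_ fj fs] fl] := chain_le (leq_maxr j k).
rewrite -el -fl /= => /label_inj aa' /label_inj bb'.
by rewrite ej fj es fs aa' bb'.
Qed.

Definition union_type := {x : nat | exists k a, label (S k) a = x}.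

Definition union_inj k (a : S k) : union_type :=
  exist _ (label (S k) a) (ex_intro _ k (ex_intro _ a erefl)).

Lemma union_eq (x y : union_type) : sval x = sval y -> x = y.
Proof. by case: x y => [x px] [y py] /= xy; apply: eq_exist. Qed.

(** A finite tuple of the union already lies in all late stages. *)
Lemma union_tuple n (w : 'I_n -> union_type) :
  exists K, forall k, K <= k ->
  exists u : 'I_n -> S k, @union_inj k \o u = w.
Proof.
have /choice[K Kw] (i : 'I_n) : exists k, exists a, label (S k) a = sval (w i).
  exact: (svalP (w i)).
exists (\max_(i < n) K i) => k Kk.
have /choice[u uw] (i : 'I_n) : exists a : S k, union_inj a = w i.
  have [a aw] := Kw i.
  have [|e ee el] := @chain_le (K i) k.
    by apply: leq_trans Kk; apply: leq_bigmax.
  by exists (e a); apply: union_eq; rewrite -aw -el.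
by exists u; apply/funext.
Qed.

Lemma union_exists : exists (M : structure) (lab : M -> nat)
    (g : forall k, S k -> M),
  [/\ injective lab, forall k, embedding (g k),
      forall k a, lab (g k a) = label (S k) a &
      forall n (w : 'I_n -> M), exists K, forall k, K <= k ->
      exists u : 'I_n -> S k, g k \o u = w].
Proof.
have pair (x y : union_type) : exists k (a b : S k),
    union_inj a = x /\ union_inj b = y.
  have [k /(_ k (leqnn k))[u uxy]] :=
    union_tuple (fun i : 'I_2 => if i == ord0 then x else y).
  exists k, (u ord0), (u (lift ord0 ord0)).
  by rewrite -[union_inj _]/((@union_inj k \o u) ord0)
    -[X in _ /\ X = _]/((@union_inj k \o u) (lift ord0 ord0)) uxy.
have /choice[j jP] (xy : union_type * union_type) : exists z,
    forall k (a b : S k), union_inj a = xy.1 -> union_inj b = xy.2 ->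
    union_inj (a \v b) = z.
  have [k [a [b [<- <-]]]] := pair xy.1 xy.2; exists (union_inj (a \v b)).
  move=> k' a' b' [aa'] [bb']; apply: union_eq => /=.
  by case: (chain_coherent aa' bb').
pose M := @Structure union_type (fun x y => j (x, y))
  (fun x y => exists k (a b : S k),
     [/\ union_inj a = x, union_inj b = y & a \sq b]).
exists M, sval, union_inj; split=> //; last exact: union_tuple.
  exact: union_eq.
move=> k; split.
- by move=> a b [/label_inj].
- by move=> a b; apply: jP.
- move=> a b; split=> [ab|[k' [a' [b' [[aa'] [bb'] ab']]]]].
    by exists k, a, b.
  by apply/(chain_coherent aa' bb').2.
Qed.

End Union.

(** * Solving all extension problems *)

(** ['I_m] itself cannot be a carrier, for its universe is larger than that of
    carriers. *)
Definition below (m : nat) := {i : nat | i < m}.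

Definition ord_of_below m (i : below m) : 'I_m := Ordinal (svalP i).

Definition below_of_ord m (i : 'I_m) : below m := exist _ (val i) (ltn_ord i).

Lemma ord_of_belowK m : cancel (@ord_of_below m) (@below_of_ord m).
Proof. by move=> [i lt_im]; apply: eq_exist. Qed.

Lemma below_of_ordK m : cancel (@below_of_ord m) (@ord_of_below m).
Proof. by move=> i; apply: val_inj. Qed.

Definition coded_structure m (j : {ffun 'I_m * 'I_m -> 'I_m})
    (r : {ffun 'I_m * 'I_m -> bool}) : structure :=
  @Structure (below m)
    (fun a b => below_of_ord (j (ord_of_below a, ord_of_below b)))
    (fun a b => r (ord_of_below a, ord_of_below b)).

Lemma coded_structure_finite m j r : finite_structure (@coded_structure m j r).
Proof.
apply: (@sub_finite_set _ _ (range (@below_of_ord m))).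
  by move=> i _; exists (ord_of_below i); rewrite ?ord_of_belowK.
exact/finite_image/finite_finset.
Qed.

Lemma coded_structure_exists (B : structure) : finite_structure B ->
  exists m j r (f : B -> @coded_structure m j r), isomorphism f.
Proof.
move=> /(@finite_seqP {classic B})[s0 Bs0]; pose s := undup s0.
have sP (b : {classic B}) : b \in s.
  have : [set: {classic B}] b by [].
  by rewrite Bs0 /= mem_undup.
have us : uniq s by apply: undup_uniq.
pose m := size s; pose h (i : 'I_m) : B := tnth (in_tuple s) i.
have [f fK hK] : bijective h.
  apply: surjective_bijective => [|b]; first exact/(tuple_uniqP (in_tuple s)).
  by have /(tnthP (in_tuple s))[i ->] := sP b; exists i.
exists m, [ffun ij => f (h ij.1 \v h ij.2)],
  [ffun ij => `[< h ij.1 \sq h ij.2 >]].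
pose c b := below_of_ord (f b); pose c' i := h (ord_of_below i).
have cK : cancel c c' by move=> b; rewrite /c /c' below_of_ordK hK.
have c'K : cancel c' c by move=> i; rewrite /c /c' fK ord_of_belowK.
exists c; split; last by exists c'.
split; first exact: can_inj cK.
- by move=> a b; rewrite /= /join /= ffunE /= !below_of_ordK !hK.
- move=> a b; rewrite /= /spec /= ffunE /= !below_of_ordK !hK.
  by split=> [/asboolP|/asboolP].
Qed.

(** An extension problem is a table for a finite structure, a tuple in it, and
    the labels of a tuple in some stage. *)
Definition problem : countType :=
  {mn : nat * nat &
   ({ffun 'I_mn.1 * 'I_mn.1 -> 'I_mn.1} * {ffun 'I_mn.1 * 'I_mn.1 -> bool} *
    ({ffun 'I_mn.2 -> 'I_mn.1} * {ffun 'I_mn.2 -> nat}))%type}.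

Definition solves (s s' : stage) (p : problem) : Prop :=
  let: existT mn ((j, r), (v, w)) := p in
  let B := coded_structure j r in
  let v' : 'I_mn.2 -> B := @below_of_ord _ \o v in
  specialization_semilattice B ->
  forall u : 'I_mn.2 -> s, same_atomic v' u -> label s \o u = w ->
  exists2 f : B -> s', embedding f & label s' \o f \o v' = w.

Lemma stage_solve (s : stage) (p : problem) :
  exists2 s', stage_le s s' & solves s s' p.
Proof.
case: p => mn [[j r] [v w]] /=; pose B := coded_structure j r.
pose v' : 'I_mn.2 -> B := @below_of_ord _ \o v.
have [[hB [u [vu uw]]]|no] := pselect (specialization_semilattice B /\
    exists u : 'I_mn.2 -> s, same_atomic v' u /\ label s \o u = w).
  have fB : finite_specialization_semilattices B.
    by split=> //; apply: coded_structure_finite.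
  have [s' ss' [f fe fv]] := stage_extend fB vu.
  by exists s' => // _ u' _ _; exists f => //; rewrite fv.
exists s; first exact: stage_le_refl.
by move=> hB u vu uw; case: no; split=> //; exists u.
Qed.

(** An injective sequence of natural numbers is unbounded; thus a problem [x],
    numbered by all [pickle (x, i)], comes up at arbitrarily late stages. *)
Lemma pickle_unbounded (T : countType) (x : T) K :
  exists i, K <= pickle ((x, i) : T * nat).
Proof.
apply: contrapT => no.
have lt i : pickle ((x, i) : T * nat) < K.
  by rewrite ltnNge; apply/negP => le; apply: no; exists i.
pose f (i : 'I_K.+1) : 'I_K := Ordinal (lt i).
have fi : injective f.
  move=> i i' /(congr1 val)/= /(pcan_inj pickleK)[]; exact: val_inj.
by have := leq_card f fi; rewrite !card_ord ltnn.
Qed.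

(** Stage [k.+1] solves the problem numbered [k]. A problem posed in the union is
    already posed in all late stages, and one of them is devoted to it. *)
Theorem fraisse_limit_exists :
  exists M : structure, fraisse_limit finite_specialization_semilattices M.
Proof.
pose E := @Structure void (fun a _ => a) (fun _ _ => True).
have fE : finite_specialization_semilattices E.
  by split; [split=> -[]|apply: finite_finset].
have vi : injective (fun x : E => 0) by case.
have /choice[next nextP] (sp : stage * problem) :
    exists s', stage_le sp.1 s' /\ solves sp.1 s' sp.2.
  by have [s'] := stage_solve sp.1 sp.2; exists s'.
pose S := fix S k : stage := if k is k'.+1 then
    if (unpickle k' : option (problem * nat)) is Some (p, _) then next (S k', p)
    else S k'
  else Stage fE vi.
have S_succ k : stage_le (S k) (S k.+1).
  rewrite /=; case: unpickle => [[p i]|]; last exact: stage_le_refl.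
  exact: (nextP (S k, p)).1.
have [M [lab [g [labi ge gl gw]]]] := union_exists S_succ.
exists M; apply: finitely_injective_fraisse_limit.
- by apply/countable_injP; exists lab => x y _ _; apply: labi.
- apply: specialization_semilattice_local => v.
  have [k /(_ k (leqnn k))[u uv]] := gw _ v.
  have vu : same_atomic v u.
    by rewrite -uv; apply/same_atomic_sym/same_atomic_embedding.
  have [f [fe _]] := same_atomic_gen vu.
  exact: specialization_semilattice_embedding fe (stage_finite (S k)).1.
move=> B [hB fB] n v w vw.
have [m [j [r [c [ce [c' cK c'K]]]]]] := coded_structure_exists fB.
have hC := specialization_semilattice_embedding (embedding_cancel ce c'K) hB.
have [K uK] := gw n w.
pose p : problem := existT _ (m, n)
  ((j, r), ([ffun i => ord_of_below (c (v i))], [ffun i => lab (w i)])).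
have [i Ki] := pickle_unbounded p K; pose k := pickle ((p, i) : problem * nat).
have [u uw] := uK k Ki.
have : solves (S k) (S k.+1) p by rewrite /= /k pickleK; apply: (nextP (_, p)).2.
have cv : @below_of_ord _ \o [ffun i => ord_of_below (c (v i))] = c \o v.
  by apply/funext => l /=; rewrite ffunE ord_of_belowK.
rewrite /= cv => /(_ hC u)[||f fe fl].
- apply: same_atomic_trans (same_atomic_sym (same_atomic_embedding u (ge k))).
  rewrite uw; apply: same_atomic_trans vw.
  exact/same_atomic_sym/same_atomic_embedding.
- by apply/funext => l; rewrite /= ffunE -uw /= gl.
exists (g k.+1 \o (f \o c)).
  exact: embedding_comp (embedding_comp ce fe) (ge k.+1).
apply/funext => l; apply: labi; rewrite /= gl.
by have := congr1 (@^~ l) fl; rewrite /= ffunE.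
Qed.

Theorem theorem5p14 :
  strong_amalgamation_property specialization_semilattices
  /\ (exists M : structure, fraisse_limit finite_specialization_semilattices M)
  /\ (forall M : structure,
        fraisse_limit finite_specialization_semilattices M ->
        [/\ omega_categorical (theory_of M),
            quantifier_elimination (theory_of M)
          & model_completion (theory_of M) specialization_semilattice_theory]).
Proof.
split; first exact: specialization_semilattices_strong_amalgamation.
split; first exact: fraisse_limit_exists.
exact: fraisse_limit_model_theory.
Qed.
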